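(* Let $G=(V,E)$ be a finite weighted graph and let $(C,\phi)$ be a tree position for $G$. Suppose that for some pair of nonadjacent edges $x,y$ of $C$, with $p_1,\dots,p_i$ denoting the edges of the simple path connecting $x$ to $y$ (in order from $x$ to $y$, excluding $x$ and $y$), the following conditions hold: (1) $s(p_i,x)<0$; (2) $b(p_{t-1})\le b(p_t)$ for all $1<t\le i$; (3) $s(p_i,x)+s(p_i,y)+2a(x,y)<0$. Then $(C,\phi)$ is weakly reducible. Moreover, in this case shifting $x$ to $y$ strictly reduces the width of the tree position.
   Context: $G=(V,E)$ is a finite undirected graph in which every edge has two distinct endpoints and carries a positive real weight; $w(F)$ denotes the sum of the weights of the edges in $F\subset E$. Tree position: a $3$-Cayley tree is a connected acyclic graph in which every non-leaf vertex has degree exactly three; leaves are called boundary vertices. A tree position for $G$ is a pair $(C,\phi)$ where $C$ is a $3$-Cayley tree and $\phi$ is a one-to-one map from $V$ onto the set of boundary vertices of $C$. For an edge $f$ of $C$, $R(f)$ is the set of edges $(v,v')$ of $G$ that pass through $f$, i.e. such that $f$ lies on the unique simple path in $C$ from $\phi(v)$ to $\phi(v')$. The width of $f$ is $b(f)=w(R(f))$. The width of $(C,\phi)$ is the multiset of widths of all edges of $C$ sorted in nonincreasing order; widths of tree positions are compared lexicographically. For two distinct edges $e,g$ of $C$, the adjacency weight is $a(e,g)=w(R(e)\cap R(g))$ and the slope is $s(e,g)=w(R(g)\setminus R(e))-w(R(e)\cap R(g))$. Branch shift: let $x,y$ be edges of $C$ with no common endpoint (nonadjacent), let $p_1,\dots,p_i$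 ($i\ge1$) be the edges of the unique simple path connecting $x$ to $y$ (excluding $x$ and $y$), with vertices $w_1,\dots,w_{i+1}$, where $w_1$ is an endpoint of $x$, $w_{i+1}$ is an endpoint of $y$, and $p_t$ joins $w_t$ to $w_{t+1}$. For $2\le t\le i$ let $f_t$ be the third edge at $w_t$. Shifting $x$ to $y$ produces the tree $C'$ obtained from $C$ by detaching $x,f_2,\dots,f_i,y$ (together with the subtrees beyond them) from the path and reattaching $x$ at $w_{i+1}$, $y$ at $w_i$, and $f_t$ at $w_{t-1}$ for $2\le t\le i$. The boundary vertices are unchanged, so $(C',\phi)$ is a tree position for $G$, called a branch shift of $(C,\phi)$. $(C,\phi)$ is weakly reducible if some branch shift produces a tree position of strictly lower width. *)

(* Defs.v *)
From HB Require Import structures.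
From mathcomp Require Import all_boot all_order all_algebra.
From mathcomp Require Import boolp reals.
Set Implicit Arguments.
Unset Strict Implicit.
Unset Printing Implicit Defensive.
Import Order.TTheory GRing.Theory Num.Theory.
Local Open Scope ring_scope.

(* Parallel edges are allowed; loops are not. *)
Record wgraph (R : realType) (V E : finType) := WGraph {
  ends : E -> {set V};
  weight : E -> R;
  ends_card2 : forall e, #|ends e| = 2%N;
  weight_gt0 : forall e, 0 < weight e
}.

Definition wt (R : realType) (V E : finType) (G : wgraph R V E)
    (F : {set E}) : R :=
  \sum_(e in F) weight G e.

(* A tree with vertex type N is given by its set of edges, each of them a
   two-element set of vertices. *)
Section Trees.
Variable N : finType.
Implicit Types (C : {set {set N}}) (e f x y : {set N}) (u v : N) (q : seq N).

Definition adj C : rel N := fun u v => [set u; v] \in C.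

Definition degree C u : nat := #|[set e in C | u \in e]|.

Definition leaf C u : bool := degree C u == 1%N.

Definition cayley3 C : Prop :=
  [/\ forall e, e \in C -> #|e| = 2%N,
      forall u v, connect (adj C) u v,
      forall c : seq N, ucycle (adj C) c -> (size c <= 2)%N
    & forall u, ~~ leaf C u -> degree C u = 3%N].

(* Simple paths are nonempty vertex sequences u :: q. *)
Definition simple_path C u q : bool := path (adj C) u q && uniq (u :: q).

Definition path_edges u q : seq {set N} :=
  pairmap (fun a b => [set a; b]) u q.

(* For q of size i, the path w_1 :: q has vertices w_1, ..., w_(i+1) and edges
   p_1, ..., p_i; both functions below are indexed from 1. *)
Definition pvertex (w1 : N) q (t : nat) : N := nth w1 (w1 :: q) t.-1.

Definition pedge (w1 : N) q (t : nat) : {set N} :=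
  nth set0 (path_edges w1 q) t.-1.

(* w1 :: q is the simple path connecting the nonadjacent edges x and y, with
   x and y themselves excluded. *)
Definition connects C x y (w1 : N) q : bool :=
  [&& x \in C, y \in C, [disjoint x & y], simple_path C w1 q,
      w1 \in x, last w1 q \in y,
      x \notin path_edges w1 q & y \notin path_edges w1 q].

(* The edge f, moved from its endpoint u to v. *)
Definition reattach f u v : {set N} := v |: (f :\ u).

(* In a 3-Cayley tree, for 2 <= t <= size q, the vertex w_t has degree three
   and this is a singleton {f_t}, since two of the edges at w_t are on the
   path. *)
Definition third_edge C (w1 : N) q (t : nat) : {set {set N}} :=
  [set f in C | (pvertex w1 q t \in f) && (f \notin path_edges w1 q)].

(* x is moved from w_1 to w_(i+1), y from w_(i+1) to w_i, and each f_t from w_t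
   to w_(t-1); the vertex type, hence phi, is unchanged. *)
Definition shift C x y (w1 : N) q : {set {set N}} :=
  let i := size q in
  let w := pvertex w1 q in
  let detached :=
    [set x; y] :|: \bigcup_(2 <= t < i.+1) third_edge C w1 q t in
  let reattached :=
    [set reattach x (w 1%N) (w i.+1); reattach y (w i.+1) (w i)]
      :|: \bigcup_(2 <= t < i.+1)
            [set reattach f (w t) (w t.-1) | f in third_edge C w1 q t] in
  (C :\: detached) :|: reattached.

End Trees.

Section TreePositions.
Variables (R : realType) (V E N : finType) (G : wgraph R V E).
Implicit Types (C : {set {set N}}) (phi : V -> N) (e f g : {set N}).

Definition tree_position C phi : Prop :=
  [/\ cayley3 C, injective phi & forall u, (u \in codom phi) = leaf C u].

Definition passing C phi f : {set E} :=
  [set e | `[< exists (v v' : V) (q : seq N),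
                 [/\ ends G e = [set v; v'],
                     simple_path C (phi v) q,
                     last (phi v) q = phi v'
                   & f \in path_edges (phi v) q] >]].

Definition edge_width C phi f : R := wt G (passing C phi f).

Definition adj_weight C phi e g : R :=
  wt G (passing C phi e :&: passing C phi g).

Definition slope C phi e g : R :=
  wt G (passing C phi g :\: passing C phi e) - adj_weight C phi e g.

(* seqlexi equips sequences with the lexicographic order. *)
Definition width C phi : seqlexi R :=
  sort >=%R [seq edge_width C phi f | f <- enum C].

Definition weakly_reducible C phi : Prop :=
  exists (x y : {set N}) (w1 : N) (q : seq N),
    [/\ connects C x y w1 q,
        tree_position (shift C x y w1 q) phi
      & (width (shift C x y w1 q) phi < width C phi)%O].

End TreePositions.

(* Main.v *)
Require Import Defs.
From mathcomp Require Import all_boot all_order all_algebra.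
From mathcomp Require Import boolp reals.
From mathcomp Require Import zify lra.
Set Implicit Arguments.
Unset Strict Implicit.
Unset Printing Implicit Defensive.
Import Order.TTheory GRing.Theory Num.Theory.
Local Open Scope ring_scope.

(* In a tree every edge f is the only edge crossing some vertex set S, and R(f)
   is then the set of edges of G crossing the preimage of S.  Put f_1 = x and
   f_(i+1) = y: the shift rotates the attachments of f_1, ..., f_(i+1) along the
   path.  Edges off the path keep their cut, hence their width, while the cuts
   of the path edges change so that
     b'(p_t) = b(p_(t+1)) + s(p_(t+1), x)                     for t < i,
     b'(p_i) = b(p_i) + s(p_i, x) + s(p_i, y) + 2 a(x, y).
   As s(p_t, x) increases with t, all new path widths are < b(p_i), the largest
   old one, so the sorted width decreases.  That every edge of the new graph has
   a cut also shows that it is acyclic. *)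

(** * Cuts of a tree *)

Section Cuts.
Variable N : finType.
Implicit Types (C : {set {set N}}) (f h S : {set N}) (u v : N) (q : seq N).

Definition crosses S h : bool := (h :&: S != set0) && (h :\: S != set0).

Definition is_cut C f S : Prop := forall h, h \in C -> crosses S h = (h == f).

Lemma crosses2 S u v : crosses S [set u; v] = (u \in S) (+) (v \in S).
Proof.
apply/andP/idP => [[/set0Pn[a /setIP[ha aS]] /set0Pn[b /setDP[hb bS]]]|].
  by case/set2P: ha aS => -> aS; case/set2P: hb bS => -> bS;
    move: aS bS; do 2?[case: (_ \in S)].
case uS: (u \in S); case vS: (v \in S) => //= _; split; apply/set0Pn.
- by exists u; rewrite !inE uS eqxx.
- by exists v; rewrite !inE vS eqxx orbT.
- by exists v; rewrite !inE vS eqxx orbT.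
- by exists u; rewrite !inE uS eqxx.
Qed.

Lemma crossesC S h : crosses (~: S) h = crosses S h.
Proof. by rewrite /crosses setDE setCK andbC -setDE. Qed.

Lemma is_cutC C f S : is_cut C f S -> is_cut C f (~: S).
Proof. by move=> cS h hC; rewrite crossesC cS. Qed.

(** Turns an identity between sides of cuts into one between sets of passing edges. It is applied to
    edges of [G], with preimages of sides under [phi]. *)
Lemma crosses_addb (S S1 S2 : {set N}) h : #|h| = 2%N ->
  (forall v, v \in h -> (v \in S) = (v \in S1) (+) (v \in S2)) ->
  crosses S h = crosses S1 h (+) crosses S2 h.
Proof.
move=> /eqP/cards2P[a [b [_ ->]]] e.
by rewrite !crosses2 (e a (set21 _ _)) (e b (set22 _ _)) addbACA.
Qed.

Lemma path_edges_sub u q f v : f \in path_edges u q -> v \in f -> v \in u :: q.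
Proof.
elim: q u => //= a q IH u; rewrite inE => /orP[/eqP->|/IH fq /fq].
  by rewrite !inE => /orP[] /eqP->; rewrite eqxx ?orbT.
by rewrite !inE => ->; rewrite orbT.
Qed.

Lemma path_edges_subset C u q f :
  path (adj C) u q -> f \in path_edges u q -> f \in C.
Proof.
elim: q u => //= a q IH u /andP[ua aq]; rewrite inE => /orP[/eqP->//|].
exact: IH.
Qed.

(** Along the path, membership in [S] flips exactly when [f] is traversed, and a simple path
    traverses [f] at most once. *)
Lemma cut_path C f S u q : is_cut C f S -> simple_path C u q ->
  (f \in path_edges u q) = (u \in S) (+) (last u q \in S).
Proof.
move=> cS; elim: q u => [|v q IH] u; first by rewrite /= addbb.
move=> /andP[/= /andP[uv vq] /andP[u_vq uq]].
have IHv : simple_path C v q by rewrite /simple_path vq.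
have := cS _ uv; rewrite crosses2 => cuv.
rewrite inE eq_sym -(addKb (v \in S) (last v q \in S)) -(IH _ IHv) addbA cuv.
case: eqP => //= fE; rewrite -fE; apply/esym/negP.
by move=> /path_edges_sub/(_ (set21 _ _)); apply/negP.
Qed.

(** Take the cut of the first edge uv of a cycle. The rest of the cycle avoids uv and so stays on
    the side of v; hence the closing edge crosses the cut too, must be uv itself, and the cycle has
    only two vertices. *)
Lemma cuts_acyclic C (c : seq N) :
  (forall f, f \in C -> exists S, is_cut C f S) ->
  ucycle (adj C) c -> (size c <= 2)%N.
Proof.
move=> cuts /andP[]; case: c => [|u [|v q]] //=.
rewrite rcons_path => /and3P[uv vq vu] /andP[u_vq uq].
have [S cS] := cuts _ uv.
have := cut_path (q := q) (u := v) cS; rewrite /simple_path vq /= uq => /(_ isT).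
rewrite (negbTE (_ : [set u; v] \notin _)); last first.
  by apply/negP => /path_edges_sub/(_ (set21 _ _)); apply/negP.
have := cS _ vu; have := cS _ uv; rewrite !crosses2 eqxx.
move=> /esym e1 + /esym e2.
have -> : (last v q \in S) (+) (u \in S).
  by move: e1 e2; case: (u \in S); case: (v \in S); case: (last v q \in S).
move=> /esym/eqP lE.
have : last v q \in [set u; v] by rewrite -lE set21.
have lq : last v q \in v :: q by rewrite mem_last.
rewrite !inE => /orP[/eqP luE|/eqP lvE]; first by rewrite luE (negbTE u_vq) in lq.
case: q uq lvE {lE lq e2 u_vq vq vu} => //= a q /andP[+ _] aE.
by rewrite -{1}aE mem_last.
Qed.

Lemma tree_cut C f : cayley3 C -> f \in C -> exists S, is_cut C f S.
Proof.
move=> [C2 _ acyc _] fC; have /eqP/cards2P[a [b [ab fE]]] := C2 _ fC.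
(* The side is the component of [a] once [f] is removed. Every other edge stays inside one
   component, so it remains to separate [a] from [b]. *)
exists [set v | connect (adj (C :\ f)) a v] => h hC.
have symC : connect_sym (adj (C :\ f)).
  by apply: sym_connect_sym => u v; rewrite /adj setUC.
have /eqP/cards2P[u [v [_ hE]]] := C2 _ hC; rewrite hE crosses2 !inE -hE.
have [hf|hf] := eqVneq h f; last first.
  have uv : connect (adj (C :\ f)) u v.
    by apply: connect1; rewrite /adj -hE !inE hf.
  by rewrite (same_connect_r symC uv) addbb.
suff nab : ~~ connect (adj (C :\ f)) a b.
  have uab : u \in [set a; b] by rewrite -fE -hf hE set21.
  have vab : v \in [set a; b] by rewrite -fE -hf hE set22.
  have abv : b \in [set u; v] by rewrite -hE hf fE set22.
  have aav : a \in [set u; v] by rewrite -hE hf fE set21.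
  have C0 := connect0 (adj (C :\ f)) a.
  case/set2P: uab abv aav => ->; case/set2P: vab => ->; rewrite ?C0 ?(negbTE nab) //.
    by rewrite !inE orbb eq_sym (negbTE ab).
  by rewrite !inE orbb (negbTE ab).
apply/negP => /connectP[q0 aq0 bE]; case/shortenP: aq0 bE => q aq uq _ bE.
have cyc : ucycle (adj C) (a :: q).
  rewrite /ucycle uq /= rcons_path -bE andbT /adj setUC -fE fC andbT.
  by apply: sub_path aq => c d; rewrite /adj !inE => /andP[].
(* A cycle of at most two vertices leaves two cases: either [a] is [b], or the path is the single
   edge [f], which was removed. *)
have := acyc _ cyc; case: q aq bE {uq cyc} => [_ baE|c [|//]] /=.
  by rewrite baE eqxx in ab.
by rewrite andbT => + bc; rewrite -bc /adj !inE fE eqxx.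
Qed.

Lemma nth_path_edges w1 q k : (k < size q)%N ->
  nth set0 (path_edges w1 q) k = [set nth w1 (w1 :: q) k; nth w1 (w1 :: q) k.+1].
Proof. by move=> kq; rewrite /path_edges (nth_pairmap w1). Qed.

Lemma path_edgesP w1 q f : reflect
  (exists2 k, (k < size q)%N & f = [set nth w1 (w1 :: q) k; nth w1 (w1 :: q) k.+1])
  (f \in path_edges w1 q).
Proof.
apply: (iffP (nthP set0)) => [[k]|[k kq ->]].
  by rewrite size_pairmap => kq <-; exists k; rewrite ?nth_path_edges.
by exists k; rewrite ?size_pairmap ?nth_path_edges.
Qed.

(* pi v is the position on the path of the path vertex nearest to v. *)
Lemma path_projection C w1 q :
  (forall f, f \in C -> exists S, is_cut C f S) -> simple_path C w1 q ->
  exists pi : N -> nat,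
    [/\ forall v, (pi v <= size q)%N,
        forall k, (k <= size q)%N -> pi (nth w1 (w1 :: q) k) = k
      & forall a b, [set a; b] \in C -> [set a; b] \notin path_edges w1 q ->
          pi a = pi b].
Proof.
move=> cuts; elim: q w1 => [|w2 q IH] w1.
  by move=> _; exists (fun=> 0%N); split => // -[|k].
move=> /andP[/= /andP[w12 w2q] /andP[w1_q uq]].
have [|pi [pi_le piW piC]] := IH w2; first by rewrite /simple_path w2q.
have [S cS w1S] : exists2 S, is_cut C [set w1; w2] S & w1 \in S.
  have [S cS] := cuts _ w12; have [|w1S] := boolP (w1 \in S); first by exists S.
  by exists (~: S); [exact: is_cutC | rewrite inE].
have w2S : w2 \notin S.
  by have := cS _ w12; rewrite crosses2 w1S eqxx; case: (w2 \in S).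
(* The path from [w2] on never returns to [S]: an edge doing so would be the edge from [w1] to [w2],
   but [w1] does not recur. *)
have qS k : (k <= size q)%N -> nth w2 (w2 :: q) k \notin S.
  elim: k => [//|k IHk] kq; have := IHk (ltnW kq); apply: contraNN => kS.
  have eq : [set nth w2 (w2 :: q) k; nth w2 (w2 :: q) k.+1] \in path_edges w2 q.
    by apply/path_edgesP; exists k.
  have := cS _ (path_edges_subset w2q eq); rewrite crosses2 kS.
  case: (_ \in S) => //= /esym/eqP kE.
  by have := path_edges_sub eq (_ : w1 \in _); rewrite kE set21 (negbTE w1_q) => /(_ isT).
exists (fun v => if v \in S then 0%N else (pi v).+1); split=> [v|k|a b abC].
- by case: ifP => // _; rewrite ltnS.
- case: k => [|k]; first by rewrite /= w1S.
  rewrite ltnS => kq; have -> : nth w1 [:: w1, w2 & q] k.+1 = nth w2 (w2 :: q) k.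
    by apply: set_nth_default.
  by rewrite (negbTE (qS _ kq)) piW.
rewrite inE negb_or => /andP[ab1 abq].
have := cS _ abC; rewrite crosses2 (negbTE ab1) (piC _ _ abC abq).
by case: (a \in S); case: (b \in S).
Qed.

End Cuts.

(** * Rotating the branches along a path *)

Section Rotation.
Variables (N : finType) (C : {set {set N}}) (w1 : N) (q : seq N).
(* Positions on the path are counted from 0: w t is w_(t+1), and fe t is an edge
   off the path attached there. *)
Variables (fe : nat -> {set N}) (pi : N -> nat).
Local Notation W := (w1 :: q).
Local Notation P := (path_edges w1 q).
Local Notation i := (size q).
Local Notation w := (nth w1 (w1 :: q)).
Hypothesis C2 : forall f, f \in C -> #|f| = 2%N.
Hypothesis cuts : forall f, f \in C -> exists S, is_cut C f S.
Hypothesis conC : forall u v, connect (adj C) u v.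
Hypothesis simW : simple_path C w1 q.
Hypothesis feC : forall t, (t <= i)%N -> fe t \in C.
Hypothesis feP : forall t, (t <= i)%N -> fe t \notin P.
Hypothesis few : forall t, (t <= i)%N -> w t \in fe t.
Hypothesis pi_le : forall v, (pi v <= i)%N.
Hypothesis piW : forall k, (k <= i)%N -> pi (w k) = k.
Hypothesis piC : forall a b, [set a; b] \in C -> [set a; b] \notin P -> pi a = pi b.
Implicit Types (f g h S : {set N}) (a b u v : N) (k t : nat).

Definition prev_pos t : nat := if t == 0%N then i else t.-1.
Definition next_pos t : nat := if t == i then 0%N else t.+1.

(** The endpoint map depends on the edge [h], so moved and unmoved edges share one formula. For [v]
    on the path, [pi v] is its own position; [prev_pos] is the cyclic predecessor, sending 0 to the
    far end. *)
Definition new_end h v : N :=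
  if (v \in W) && (h == fe (pi v)) then w (prev_pos (pi v)) else v.

Definition rotate_edge h : {set N} := [set new_end h v | v in h].

Definition rotate : {set {set N}} := [set rotate_edge h | h in C].

Lemma prev_pos_le t : (t <= i)%N -> (prev_pos t <= i)%N.
Proof. by rewrite /prev_pos; case: eqP; lia. Qed.

Lemma next_pos_le t : (t <= i)%N -> (next_pos t <= i)%N.
Proof. by rewrite /next_pos; case: eqP; lia. Qed.

Lemma next_posK t : (t <= i)%N -> prev_pos (next_pos t) = t.
Proof. by rewrite /prev_pos /next_pos; case: (t =P i) => //=; lia. Qed.

Lemma prev_posK t : (t <= i)%N -> next_pos (prev_pos t) = t.
Proof.
by rewrite /prev_pos /next_pos; case: (t =P 0)%N => [->|?]; [case: eqP | case: eqP]; lia.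
Qed.

Lemma mem_pathP v : reflect (exists2 t, (t <= i)%N & v = w t) (v \in W).
Proof.
apply: (iffP (nthP w1)) => [[t]|[t ti ->]]; first by rewrite ltnS => ti <-; exists t.
by exists t.
Qed.

Lemma mem_w t : (t <= i)%N -> w t \in W.
Proof. by move=> ti; apply/mem_pathP; exists t. Qed.

Lemma pi_path v : v \in W -> v = w (pi v).
Proof. by case/mem_pathP=> t ti ->; rewrite piW. Qed.

Lemma edge2 h : h \in C -> exists a b, a != b /\ h = [set a; b].
Proof. by move=> /C2/eqP/cards2P[a [b [ab ->]]]; exists a, b. Qed.

Lemma path_edge_in h : h \in P -> h \in C.
Proof. by case/andP: simW => pW _; apply: path_edges_subset. Qed.

Lemma branch_edge h v : h \in C -> h \notin P -> v \in h ->
  exists2 u, h = [set v; u] & pi u = pi v.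
Proof.
move=> hC hP; have [a [b [_ hE]]] := edge2 hC.
have := piC (a := a) (b := b); rewrite -hE => /(_ hC hP) ab.
by rewrite hE => /set2P[]->; [exists b | exists a; rewrite // setUC].
Qed.

(** The path has no chords: [pi] agrees on the two ends of an edge off the path but is injective on
    path vertices. *)
Lemma branch_edge_uniq h u v : h \in C -> h \notin P -> u \in h -> v \in h ->
  u \in W -> v \in W -> u = v.
Proof.
move=> hC hP uh vh uW vW; have [c hE pic] := branch_edge hC hP uh.
move: vh; rewrite hE => /set2P[->//|vE].
by rewrite (pi_path uW) (pi_path vW) vE pic.
Qed.

Lemma new_end_in h v : (new_end h v \in W) = (v \in W).
Proof.
rewrite /new_end; case: ifP => // /andP[-> _].
by rewrite mem_w // prev_pos_le.
Qed.

Lemma new_end_out h v : v \notin W -> new_end h v = v.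
Proof. by rewrite /new_end => /negPf->. Qed.

Lemma new_end_w h t : (t <= i)%N ->
  new_end h (w t) = if h == fe t then w (prev_pos t) else w t.
Proof. by move=> ti; rewrite /new_end mem_w //= piW. Qed.

Lemma rotate_edge2 h a b : h = [set a; b] ->
  rotate_edge h = [set new_end h a; new_end h b].
Proof. by rewrite /rotate_edge => {2}->; rewrite imsetU1 imset_set1. Qed.

Lemma rotate_id h : h \in C -> (forall t, (t <= i)%N -> h != fe t) ->
  rotate_edge h = h.
Proof.
move=> hC hf; rewrite /rotate_edge -[RHS](imset_id h).
apply: eq_in_imset => v vh; rewrite /new_end.
by rewrite (negbTE (hf _ (pi_le v))) andbF.
Qed.

Lemma rotate_path_edge h : h \in P -> rotate_edge h = h.
Proof.
move=> hP; apply: rotate_id => [|t ti]; first exact: path_edge_in.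
by apply: contraNneq (feP ti) => <-.
Qed.

(** The other endpoint of [fe t] is off the path, hence stays put, and only [w t] is replaced. *)
Lemma rotate_fe t : (t <= i)%N ->
  rotate_edge (fe t) = reattach (fe t) (w t) (w (prev_pos t)).
Proof.
move=> ti; have [u fE piu] := branch_edge (feC ti) (feP ti) (few ti).
have uN : u != w t.
  by apply: contra_eqN (C2 (feC ti)) => /eqP uE; rewrite fE uE setUid cards1.
have uW : u \notin W.
  apply: contra uN => uW; apply/eqP.
  by apply: (branch_edge_uniq (feC ti) (feP ti)); rewrite ?mem_w ?few // fE set22.
rewrite (rotate_edge2 fE) new_end_w // eqxx new_end_out // /reattach fE.
apply/setP => v; rewrite !inE.
by case: (v =P u) => [->|]; rewrite ?uN ?orbT //=; case: (v == w t).
Qed.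

Lemma cross_rotate h S : h \in C -> [disjoint S & W] ->
  crosses S (rotate_edge h) = crosses S h.
Proof.
move=> hC SW; have [a [b [_ hE]]] := edge2 hC.
rewrite (rotate_edge2 hE) [in RHS]hE !crosses2.
have new_mem v : (new_end h v \in S) = (v \in S).
  have [vW|vW] := boolP (v \in W); last by rewrite new_end_out.
  have := disjointFl SW vW => ->; apply: (disjointFl SW).
  by rewrite new_end_in.
by rewrite !new_mem.
Qed.

(** No path edge crosses the cut of [h], so the whole path lies on one side; the other side is
    chosen. Such a side is insensitive to moving endpoints within the path. *)
Lemma branch_cut h : h \in C -> h \notin P ->
  exists2 S, is_cut C h S & [disjoint S & W].
Proof.
move=> hC hP; have [S cS] := cuts hC.
have SW v : v \in W -> (v \in S) = (w1 \in S).
  case/mem_pathP => k + ->; elim: k => // k IHk ki.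
  rewrite -IHk ?(ltnW ki) //.
  have eP : [set w k; w k.+1] \in P by apply/path_edgesP; exists k.
  have := cS _ (path_edge_in eP); rewrite crosses2.
  have -> : [set w k; w k.+1] == h = false.
    by apply: contraNF hP => /eqP<-.
  by case: (w k \in S); case: (w k.+1 \in S).
have [wS|wS] := boolP (w1 \in S).
  exists (~: S); first exact: is_cutC.
  rewrite disjoint_sym; apply/pred0P => v /=.
  by apply/negbTE/negP => /andP[/SW + ]; rewrite inE => ->; rewrite wS.
exists S => //.
rewrite disjoint_sym; apply/pred0P => v /=.
by apply/negbTE/negP => /andP[/SW -> ]; apply/negP.
Qed.

(** [pi] is constant on edges off the path and grows by one along each path edge, so only one edge
    passes from k to k+1. *)
Lemma position_cut k : (k < i)%N ->
  is_cut C [set w k; w k.+1] [set v | pi v <= k]%N.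
Proof.
move=> ki h hC; have [hP|hP] := boolP (h \in P); last first.
  have [a [b [_ hE]]] := edge2 hC.
  have ab : pi a = pi b by apply: piC; rewrite -hE.
  rewrite {1}hE crosses2 !inE ab addbb; apply/esym/negbTE.
  by apply: contraNneq hP => ->; apply/path_edgesP; exists k.
have [j ji ->] := path_edgesP _ _ _ hP.
rewrite crosses2 !inE !piW //; last exact: ltnW.
have [->|jk] := eqVneq j k; first by rewrite !eqxx leqnn ltnn.
transitivity false; first by lia.
apply/esym/negbTE/eqP => /setP e.
have := e (w j); have := e (w j.+1); rewrite !inE !eqxx !orbT.
have wq s t : (s <= i)%N -> (t <= i)%N -> (w s == w t) = (s == t).
  by move=> si ti; apply: nth_uniq => //; case/andP: simW.
by rewrite !wq; lia.
Qed.

(** Cutting a side down to the fibre of [pi] over [t] creates no new crossing, since edges off the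
    path stay within a fibre and the side contains no path vertex. *)
Lemma fe_cut t : (t <= i)%N -> exists2 S, is_cut C (fe t) S &
  [disjoint S & W] /\ S \subset [set v | pi v == t].
Proof.
move=> ti; have [S cS SW] := branch_cut (feC ti) (feP ti).
exists (S :&: [set v | pi v == t]); last first.
  split; last exact: subsetIr.
  by apply: disjointWl SW; apply/subsetP => v /setIP[].
move=> h hC; have [a [b [_ hE]]] := edge2 hC.
rewrite {1}hE crosses2 !inE.
have [hP|hP] := boolP (h \in P).
  have := @path_edges_sub _ w1 q h; rewrite hE => sub.
  rewrite hE in hP.
  rewrite (disjointFl SW (sub a hP (set21 _ _))) (disjointFl SW (sub b hP (set22 _ _))) /=.
  by apply/esym/negbTE; apply: contraTneq hP => ->; exact: feP.
have ab : pi a = pi b by apply: piC; rewrite -hE.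
have ch := cS _ hC; rewrite {1}hE crosses2 in ch.
rewrite -ab; case: eqP => [|pit]; first by rewrite !andbT.
rewrite !andbF /=; apply/esym/negbTE/eqP => hf; apply: pit.
have := few ti; rewrite -hf hE => /set2P[]; last rewrite ab; move=> <-; exact: piW.
Qed.

(** With a single branch at [w t], everything in the fibre except [w t] lies beyond [fe t]. This is
    the situation at the inner path vertices. *)
Lemma lone_fe_cut t : (t <= i)%N ->
  (forall h, h \in C -> h \notin P -> w t \in h -> h = fe t) ->
  is_cut C (fe t) [set v | (pi v == t) && (v \notin W)].
Proof.
move=> ti uni h hC; have [a [b [_ hE]]] := edge2 hC.
rewrite {1}hE crosses2 !inE -!in_cons.
have [hP|hP] := boolP (h \in P).
  have := @path_edges_sub _ w1 q h; rewrite hE => sub.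
  rewrite hE in hP.
  rewrite (sub a hP (set21 _ _)) (sub b hP (set22 _ _)) !andbF.
  by apply/esym/negbTE; apply: contraTneq hP => ->; exact: feP.
have ab : pi a = pi b by apply: piC; rewrite -hE.
have ab_neq : a != b by have := C2 hC; rewrite hE cards2; case: (a =P b).
have nab : ~~ ((a \in W) && (b \in W)).
  apply: contra ab_neq => /andP[aW bW]; apply/eqP.
  by apply: (branch_edge_uniq hC hP); rewrite // hE !inE eqxx ?orbT.
have wtE v : v \in W -> pi v = t -> v = w t by move=> /pi_path + <-.
rewrite -ab; case: eqP => [pit|pit] /=; last first.
  apply/esym/negbTE/eqP => hf; apply: pit.
  have := few ti; rewrite -hf hE => /set2P[]; last rewrite ab; move=> <-; exact: piW.
have wtW := mem_w ti.
have -> : (h == fe t) = (w t \in h).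
  by apply/eqP/idP => [->|/uni->//]; first exact: few.
rewrite hE in_set2; move: nab.
have -> : (w t == a) = (a \in W).
  by apply/eqP/idP => [<- //|aW]; rewrite [a in RHS]wtE.
have -> : (w t == b) = (b \in W).
  by apply/eqP/idP => [<- //|bW]; rewrite [b in RHS]wtE // -ab.
by case: (a \in W); case: (b \in W).
Qed.


Lemma mem_rotate_edge h u : h \in C -> u \notin W ->
  (u \in rotate_edge h) = (u \in h).
Proof.
move=> hC uW; apply/imsetP/idP => [[v vh uE]|uh].
  move: uW; rewrite uE new_end_in => vW.
  by rewrite new_end_out.
by exists u => //; rewrite new_end_out.
Qed.

Lemma mem_rotate_edge_w h t : h \in C -> (t <= i)%N ->
  (w t \in rotate_edge h) = (h == fe (next_pos t)) || (w t \in h) && (h != fe t).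
Proof.
move=> hC ti; apply/imsetP/orP => [[v vh wE]|].
  have : v \in W by rewrite -(new_end_in h) -wE mem_w.
  move=> /mem_pathP[s si vE]; move: wE; rewrite vE new_end_w //.
  have [hs wE|hs wE] := eqVneq h (fe s).
    left; rewrite hs -[in X in _ == X](piW ti) wE piW ?prev_pos_le //.
    by rewrite prev_posK.
  by right; rewrite wE -vE vh -(piW ti) wE piW.
have ni := next_pos_le ti.
case=> [/eqP hE|/andP[wh hf]].
  exists (w (next_pos t)); first by rewrite hE few.
  by rewrite new_end_w // hE eqxx next_posK.
by exists (w t) => //; rewrite new_end_w // (negbTE hf).
Qed.

Section NewPosition.
Variable B : nat -> {set N}.
Hypothesis cutB : forall t, (t <= i)%N -> is_cut C (fe t) (B t).
Hypothesis BW : forall t, (t <= i)%N -> [disjoint B t & W].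

(* The nearest path position after the rotation: the branch beyond fe t moves
   with fe t. *)
Definition new_pi v : nat :=
  if (v \notin W) && (v \in B (pi v)) then prev_pos (pi v) else pi v.

(** Among edges off the path, only [fe (pi b)] has its ends separated by [B (pi b)]. There [new_end]
    moves the path endpoint to the same position to which [new_pi] moves the branch. *)
Lemma new_pi_branch h a b : h \in C -> h \notin P -> a \in h -> b \in h ->
  new_pi (new_end h a) = new_pi (new_end h b).
Proof.
(* At most one end of [h] is on the path; if both [a] and [b] are, they coincide. *)
move=> hC hP; wlog bW : a b / b \notin W => [hw ah bh|].
  have [bW|bW] := boolP (b \in W); last exact: hw.
  have [aW|aW] := boolP (a \in W); last by apply/esym/hw.
  by rewrite (branch_edge_uniq hC hP ah bh aW bW).
move=> ah bh; have piab : pi a = pi b.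
  have [c hE pic] := branch_edge hC hP ah.
  by move: bh; rewrite hE => /set2P[]->.
rewrite (new_end_out h bW) /new_pi bW /=.
have [->|ab] := eqVneq a b; first by rewrite new_end_out // bW.
have hE : h = [set a; b].
  have [c hE _] := branch_edge hC hP ah.
  by move: bh ab; rewrite hE => /set2P[->|->//]; rewrite eqxx.
have := cutB (pi_le b) hC; rewrite hE crosses2 -hE.
have [aW|aW] := boolP (a \in W); last first.
  rewrite new_end_out // aW piab /=.
  have -> : (h == fe (pi b)) = false.
    apply: contraNF aW => /eqP hf; have := few (pi_le b); rewrite -hf hE.
    by case/set2P=> wE; [|move: bW]; rewrite -wE mem_w.
  by case: (a \in _); case: (b \in _).
rewrite (disjointFl (BW (pi_le b)) aW) /= => ->.
rewrite new_end_in aW /= (pi_path aW) new_end_w // piab.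
by case: ifP => _; rewrite piW // prev_pos_le.
Qed.

Lemma new_position_cut k h : (k < i)%N -> h \in C ->
  crosses [set v | new_pi v <= k]%N (rotate_edge h) = (h == [set w k; w k.+1]).
Proof.
move=> ki hC; have [hP|hP] := boolP (h \in P); last first.
  have [a [b [_ hE]]] := edge2 hC.
  rewrite (rotate_edge2 hE) crosses2 !inE.
  rewrite (new_pi_branch (b := b) hC hP) ?hE ?set21 ?set22 // addbb -hE.
  by apply/esym/negbTE; apply: contraNneq hP => ->; apply/path_edgesP; exists k.
rewrite (rotate_path_edge hP) -(position_cut ki hC).
have [a [b [_ hE]]] := edge2 hC.
have sub v : v \in h -> new_pi v = pi v.
  by move=> /(path_edges_sub hP) vW; rewrite /new_pi vW.
by rewrite hE !crosses2 ![in LHS]inE !sub ?hE ?set21 ?set22 // !inE.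
Qed.

End NewPosition.

(** Branch edges keep their old cut and path edges get a sublevel set of [new_pi]. The cuts are
    indexed by old edges because this form yields injectivity of [rotate_edge], which [is_cut] for
    the new graph then relies on. *)
Lemma rotated_cuts h : h \in C ->
  exists S, forall g, g \in C -> crosses S (rotate_edge g) = (g == h).
Proof.
move=> hC; have [/path_edgesP[k ki ->]|hP] := boolP (h \in P); last first.
  have [S cS SW] := branch_cut hC hP.
  by exists S => g gC; rewrite cross_rotate // cS.
have /choice[B HB] : forall t, exists S, (t <= i)%N ->
    is_cut C (fe t) S /\ [disjoint S & W].
  move=> t; have [ti|] := boolP (t <= i)%N; last by exists set0.
  by have [S cS [SW _]] := fe_cut ti; exists S.
exists [set v | new_pi B v <= k]%N => g gC.
by apply: new_position_cut => // t /HB[].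
Qed.

Lemma rotate_edge_inj : {in C &, injective rotate_edge}.
Proof.
move=> g h gC hC e; have [S cS] := rotated_cuts hC.
by apply/eqP; rewrite -cS // e cS.
Qed.

Lemma degree_rotate u : degree rotate u = degree C u.
Proof.
rewrite /degree.
have -> : [set e in rotate | u \in e] =
    rotate_edge @: [set h in C | u \in rotate_edge h].
  apply/setP => e; rewrite inE; apply/andP/imsetP => [[/imsetP[h hC ->] uh]|].
    by exists h; rewrite // inE hC.
  by move=> [h /[!inE]/andP[hC uh] ->]; rewrite imset_f.
rewrite card_in_imset; last first.
  by move=> g h /[!inE]/andP[gC _] /andP[hC _]; apply: rotate_edge_inj.
have [uW|uW] := boolP (u \in W); last first.
  by apply: eq_card => h; rewrite !inE; case: (boolP (h \in C)) => //= hC;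
    rewrite mem_rotate_edge.
have /mem_pathP[t ti ->] := uW.
have ni := next_pos_le ti.
have -> : [set h in C | w t \in rotate_edge h] =
    fe (next_pos t) |: ([set h in C | w t \in h] :\ fe t).
  apply/setP => h; rewrite in_setU1 in_setD1 2!in_set.
  have [hC|hC] /= := boolP (h \in C).
    by rewrite mem_rotate_edge_w // [X in _ || X]andbC.
  rewrite andbF orbF; apply/esym/negbTE.
  by apply: contraNneq hC => ->; exact: feC.
(* The vertex [w t] loses [fe t] and gains [fe (next_pos t)]. The gained edge is not already
   counted: otherwise it would contain both [w t] and [w (next_pos t)]. *)
rewrite cardsU1 [RHS](cardsD1 (fe t)) [fe t \in _]inE feC // few //; congr (_ + _)%N.
apply/eqP; rewrite eqb1 in_setD1 in_set feC //=.
apply/andP => -[/eqP nf wf]; apply: nf; congr fe.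
rewrite -[LHS]piW // -[RHS]piW //; congr pi.
by apply: (branch_edge_uniq (feC ni) (feP ni)); rewrite ?few ?mem_w.
Qed.

Lemma connect_rotate u v : connect (adj rotate) u v.
Proof.
have pC h : h \in P -> h \in rotate.
  move=> hP; rewrite -(rotate_path_edge hP); apply: imset_f.
  exact: path_edge_in.
have symr : connect_sym (adj rotate).
  by apply: sym_connect_sym => a b; rewrite /adj setUC.
have c0 a : a \in W -> connect (adj rotate) w1 a.
  case/mem_pathP => k + ->; elim: k => // k IHk ki.
  apply: connect_trans (IHk (ltnW ki)) (connect1 _).
  by apply: pC; apply/path_edgesP; exists k.
(* A moved endpoint stays on the path, which survives the rotation. So each old edge is replaced by
   a detour: along the path, over the rotated edge, and along the path again. *)
have cmu h a : connect (adj rotate) a (new_end h a).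
  have [aW|aW] := boolP (a \in W); last by rewrite new_end_out.
  by rewrite (connect_trans _ (c0 _ _)) ?new_end_in // symr c0.
apply: (connect_sub _ (conC u v)) => a b ab.
apply: connect_trans (cmu [set a; b] a) _; rewrite symr.
apply: connect_trans (cmu [set a; b] b) _; rewrite symr.
by apply: connect1; rewrite /adj -(rotate_edge2 (erefl [set a; b])) imset_f.
Qed.

Lemma rotate_is_cut h S :
  (forall g, g \in C -> crosses S (rotate_edge g) = (g == h)) -> h \in C ->
  is_cut rotate (rotate_edge h) S.
Proof.
move=> cS hC _ /imsetP[g gC ->]; rewrite cS //.
by apply/eqP/eqP => [->|/rotate_edge_inj->].
Qed.

Lemma rotate_cayley3 : cayley3 C -> cayley3 rotate.
Proof.
move=> [_ _ _ deg3]; split.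
- move=> _ /imsetP[h hC ->]; have [a [b [_ hE]]] := edge2 hC.
  (* The two new endpoints are distinct because they lie on opposite sides of the cut. *)
  have [S cS] := rotated_cuts hC; have := cS h hC.
  rewrite (rotate_edge2 hE) crosses2 eqxx cards2.
  by case: eqP => // ->; rewrite addbb.
- exact: connect_rotate.
- move=> c; apply: cuts_acyclic => _ /imsetP[h hC ->].
  have [S cS] := rotated_cuts hC; exists S; exact: rotate_is_cut.
- by move=> u; rewrite /leaf degree_rotate; apply: deg3.
Qed.

End Rotation.

(** * Lexicographic comparison and weights *)

Section Lexicographic.
Variable R : realType.
Implicit Types (u v : seq R) (M : R).

Lemma sorted_ge_head a u c : sorted >=%R (a :: u) -> a < c ->
  count (fun z => c <= z) (a :: u) = 0%N.
Proof.
move=> au ac; apply/eqP; rewrite -leqn0 leqNgt -has_count; apply/hasPn => z.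
rewrite inE -ltNge => /predU1P[->//|zu].
have /allP/(_ z zu) : all (>=%R a) u.
  by apply: order_path_min au => b c' d; exact: ge_trans.
by move=> /= za; apply: le_lt_trans za ac.
Qed.

Lemma lexi_lt_count M u v : sorted >=%R u -> sorted >=%R v ->
  (forall c, M < c -> count (fun z => c <= z) u = count (fun z => c <= z) v) ->
  (count (fun z => M <= z)%R u < count (fun z => M <= z)%R v)%N ->
  ((u : seqlexi R) < v)%O.
Proof.
elim: u v => [|a u IH] [|b v] //= su sv gtM ltM.
have Mb : M <= b.
  by rewrite leNgt; apply: contraTN ltM => /(sorted_ge_head sv)/= ->.
have [aM|Ma] := ltP a M.
  by rewrite ltxi_cons (ltW (lt_le_trans aM Mb)) leNgt (lt_le_trans aM Mb).
have ab : a = b.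
  have [ab|ba|//] := ltgtP a b.
    have := gtM b (le_lt_trans Ma ab).
    by have /= -> := sorted_ge_head su ab; rewrite lexx.
  have := gtM a (le_lt_trans Mb ba).
  by have /= -> := sorted_ge_head sv ba; rewrite lexx.
rewrite ltxi_cons ab lexx /=; apply: IH.
- exact: path_sorted su.
- exact: path_sorted sv.
- by move=> c /gtM; rewrite ab => /addnI.
- by move: ltM; rewrite ab ltn_add2l.
Qed.

(** Changed entries never exceed [M], so counts above [M] agree. At [M] no entry is gained and [f]
    is lost. *)
Lemma sort_lexi_lt (T : eqType) (s : seq T) (b b' : T -> R) M :
  (forall f, f \in s -> b' f = b f \/ b' f < M /\ b f <= M) ->
  (exists2 f, f \in s & b f = M /\ b' f < M) ->
  ((sort >=%R (map b' s) : seqlexi R) < sort >=%R (map b s))%O.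
Proof.
move=> bb' [f fs [bf b'f]].
have tot : total (>=%R : rel R) by move=> c d; exact: ge_total.
apply: (lexi_lt_count (M := M)); rewrite ?sort_sorted //.
  move=> c Mc; rewrite !count_sort !count_map; apply: eq_in_count => g gs /=.
  case: (bb' g gs) => [->//|[b'g bg]].
  by rewrite !leNgt (lt_trans b'g Mc) (le_lt_trans bg Mc).
rewrite !count_sort !count_map -!size_filter.
rewrite (perm_size (_ : perm_eq _ (filter (fun g => (M <= b' g) && (M <= b g)) s))); last first.
  rewrite (eq_in_filter (a2 := fun g => (M <= b' g) && (M <= b g))) // => g gs /=.
  by case: (bb' g gs) => [->|[b'g _]]; rewrite ?andbb // leNgt b'g.
rewrite filter_predI size_filter -(count_predC (fun g => M <= b' g) (filter _ s)).
rewrite -[X in (X < _)%N]addn0 ltn_add2l -has_count; apply/hasP; exists f.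
  by rewrite mem_filter /= bf lexx.
by rewrite /= -ltNge.
Qed.

End Lexicographic.

Section Weights.
Variables (R : realType) (V E : finType) (G : wgraph R V E).
Implicit Types (A X Y F : {set E}).

Lemma wt_indic F : wt G F = \sum_e (e \in F)%:R * weight G e.
Proof.
rewrite /wt big_mkcond; apply: eq_bigr => e _.
by case: ifP; rewrite ?mul1r ?mul0r.
Qed.

(** With A = R(p) and X = R(x), the bracket is the slope s(p, x). *)
Lemma wt_addb A X F : (forall e, (e \in F) = (e \in A) (+) (e \in X)) ->
  wt G F = wt G A + (wt G (X :\: A) - wt G (A :&: X)).
Proof.
move=> FE; rewrite !wt_indic -sumrB -big_split; apply: eq_bigr => e _ /=.
by rewrite !inE FE; case: (e \in A); case: (e \in X) => /=; lra.
Qed.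

(** An edge in both [X] and [Y] lies in [A] by assumption, hence in [F]; the last term cancels its
    two negative contributions to the slopes. *)
Lemma wt_addb2 A X Y F :
  (forall e, (e \in F) = (e \in A) (+) (e \in X) (+) (e \in Y)) ->
  X :&: Y \subset A ->
  wt G F = wt G A + ((wt G (X :\: A) - wt G (A :&: X))
    + (wt G (Y :\: A) - wt G (A :&: Y)) + 2 * wt G (X :&: Y)).
Proof.
move=> FE /subsetP sub; rewrite !wt_indic mulr_sumr -!sumrB -!big_split.
apply: eq_bigr => e _ /=; have := sub e; rewrite !inE FE.
by case: (e \in A); case: (e \in X); case: (e \in Y) => //= h; try lra;
  have := h isT.
Qed.

(** An edge of [X] counts negatively inside the first set and positively outside, so the slope falls
    as the part of [X] inside grows. *)
Lemma wt_slope_le A A' X : X :&: A' \subset A ->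
  wt G (X :\: A) - wt G (A :&: X) <= wt G (X :\: A') - wt G (A' :&: X).
Proof.
move=> /subsetP sub; rewrite !wt_indic -!sumrB; apply: ler_sum => e _.
have := sub e; have := weight_gt0 G e; rewrite !inE.
by case: (e \in A); case: (e \in A'); case: (e \in X) => //= w0 h; try lra;
  have := h isT.
Qed.

End Weights.

(** * Passing edges of [G] as edges crossing a cut *)

Section Passing.
Variables (R : realType) (V E N : finType) (G : wgraph R V E).
Variables (C : {set {set N}}) (phi : V -> N).
Hypothesis conC : forall u v, connect (adj C) u v.

Lemma crosses_preim (S : {set N}) (v v' : V) :
  crosses (phi @^-1: S) [set v; v'] = (phi v \in S) (+) (phi v' \in S).
Proof. by rewrite crosses2 !inE. Qed.

(** By [cut_path], whether a path uses [f] depends only on the sides of its ends; connectedness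
    supplies a path. *)
Lemma passing_cut (f S : {set N}) : is_cut C f S ->
  passing G C phi f = [set e | crosses (phi @^-1: S) (ends G e)].
Proof.
move=> cS; apply/setP => e; rewrite !inE; apply/asboolP/idP.
  move=> [v [v' [q [-> pq lq]]]]; rewrite (cut_path cS pq) lq.
  by rewrite crosses_preim.
have /eqP/cards2P[v [v' [_ eE]]] := ends_card2 G e.
rewrite eE crosses_preim => cvv'.
have /connectP[q0 q0p lq0] := conC (phi v) (phi v').
case/shortenP: q0p lq0 => q qp uq _ lq.
have pq : simple_path C (phi v) q by rewrite /simple_path qp.
by exists v, v', q; split=> //; rewrite (cut_path cS pq) -lq.
Qed.

End Passing.

(** * The shift as a rotation *)

Lemma mem_bigcup_nat (T : finType) m n (F : nat -> {set T}) e :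
  reflect (exists2 t, (m <= t < n)%N & e \in F t)
          (e \in \bigcup_(m <= t < n) F t).
Proof.
rewrite big_geq_mkord; apply: (iffP bigcupP) => [[t mt eF]|[t /andP[mt tn] eF]].
  by exists (t : nat); rewrite ?ltn_ord ?andbT.
by exists (Ordinal tn).
Qed.

Section ShiftIsRotation.
Variables (N : finType) (C : {set {set N}}) (x y : {set N}) (w1 : N) (q : seq N).
Hypothesis treeC : cayley3 C.
Hypothesis xy : connects C x y w1 q.
Local Notation W := (w1 :: q).
Local Notation P := (path_edges w1 q).
Local Notation i := (size q).
Local Notation w := (nth w1 (w1 :: q)).

Lemma connects_size_gt0 : (0 < i)%N.
Proof.
case/and5P: xy => _ _ dxy _ /and4P[w1x w1y _ _].
rewrite lt0n size_eq0; apply: contraTneq w1y => ->.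
by rewrite /= (disjointFr dxy w1x).
Qed.

(** The f_(t+1) of the rotation, with f_1 = x and f_(i+1) = y. [third_edge] counts from 1, hence
    [t.+1]; the default [set0] is excluded by [third_edgeE]. *)
Definition pendant t : {set N} :=
  if t == 0%N then x else if t == i then y
  else odflt set0 [pick f in third_edge C w1 q t.+1].

Lemma pendant0 : pendant 0 = x. Proof. by []. Qed.

Lemma pendant_last : pendant i = y.
Proof. by rewrite /pendant eqxx eqn0Ngt connects_size_gt0. Qed.

Lemma w_inj s t : (s <= i)%N -> (t <= i)%N -> (w s == w t) = (s == t).
Proof. by case/and5P: xy => _ _ _ /andP[_ uW] _ si ti; apply: nth_uniq. Qed.

Lemma path_edge_mem k : (k < i)%N -> [set w k; w k.+1] \in C.
Proof.
case/and5P: xy => _ _ _ /andP[pW _] _ ki.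
by apply: (path_edges_subset pW); apply/path_edgesP; exists k.
Qed.

Lemma inner_card2 t : (0 < t < i)%N ->
  [set f in C | (w t \in f) && (f \in P)] = [set [set w t.-1; w t]; [set w t; w t.+1]].
Proof.
move=> /andP[t0 ti]; have tE := prednK t0; apply/setP => f; rewrite !inE.
apply/and3P/orP => [[fC wf /path_edgesP[k ki fE]]|].
  move: wf; rewrite fE in_set2 !w_inj //; [|exact: ltnW..].
  by case/orP=> /eqP ->; rewrite eqxx; [right | left].
case=> /eqP->; rewrite !in_set2 !eqxx ?orbT.
  have ti' : (t.-1 < i)%N by lia.
  split=> //; first by rewrite -{2}tE path_edge_mem.
  by apply/path_edgesP; exists t.-1; rewrite // tE.
split=> //; first exact: path_edge_mem.
by apply/path_edgesP; exists t.
Qed.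

Lemma inner_edges_neq t : (0 < t < i)%N -> [set w t.-1; w t] != [set w t; w t.+1].
Proof.
move=> /andP[t0 ti]; apply/eqP => /setP/(_ (w t.+1)).
by rewrite !in_set2 eqxx orbT !w_inj //; lia.
Qed.

(** Two path edges meet at an inner vertex, so it is no leaf, has degree three, and exactly one edge
    remains. *)
Lemma third_edgeE t : (0 < t < i)%N -> third_edge C w1 q t.+1 = [set pendant t].
Proof.
move=> tb; have /andP[t0 ti] := tb.
have pE : pvertex w1 q t.+1 = w t by [].
have dE : degree C (w t) = (2 + #|third_edge C w1 q t.+1|)%N.
  rewrite /degree -(cardsID [set f | f \in P]); congr (_ + _)%N.
    transitivity #|[set [set w t.-1; w t]; [set w t; w t.+1]]|; last first.
      by rewrite cards2 inner_edges_neq.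
    by rewrite -inner_card2 //; apply: eq_card => f; rewrite !inE andbA.
  apply: eq_card => f; rewrite !inE pE.
  by case: (f \in C); case: (f \in P); rewrite ?andbF ?andbT.
have d3 : degree C (w t) = 3%N.
  by case: treeC => _ _ _; apply; rewrite /leaf dE.
have /cards1P[f fE] : #|third_edge C w1 q t.+1| == 1%N by lia.
rewrite fE /pendant; have -> : (t == 0)%N = false by lia.
have -> : (t == i) = false by lia.
case: pickP => [g|/(_ f)]; rewrite fE !inE; last by rewrite eqxx.
by move=> /eqP ->.
Qed.

Lemma pendantP t : (t <= i)%N ->
  [/\ pendant t \in C, pendant t \notin P & w t \in pendant t].
Proof.
case/and5P: xy => xC yC _ _ /and4P[w1x w1y xP yP].
have [-> //|t0 ti] := posnP t.
have [->|tni] := eqVneq t i.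
  by rewrite pendant_last; split => //; rewrite -[size q]/(size W).-1 nth_last.
have : pendant t \in third_edge C w1 q t.+1.
  by rewrite third_edgeE ?set11 // t0 ltn_neqAle tni.
by rewrite inE => /and3P[].
Qed.

(** The detached edges are the pendants, the reattached ones are their rotated images, and rotation
    fixes all other edges. *)
Lemma shift_rotate (pi : N -> nat) :
  (forall k, (k <= i)%N -> pi (w k) = k) ->
  (forall v, (pi v <= i)%N) ->
  (forall a b, [set a; b] \in C -> [set a; b] \notin P -> pi a = pi b) ->
  shift C x y w1 q = rotate C w1 q pendant pi.
Proof.
move=> piW pi_le piC; have i0 := connects_size_gt0; have iE := prednK i0.
have C2 : forall f, f \in C -> #|f| = 2%N by case: treeC.
have simW : simple_path C w1 q by case/and5P: xy.
have feC t : (t <= i)%N -> pendant t \in C by case/pendantP.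
have feP t : (t <= i)%N -> pendant t \notin P by case/pendantP.
have few t : (t <= i)%N -> w t \in pendant t by case/pendantP.
pose R t := rotate_edge w1 q pendant pi (pendant t).
have RE t : (t <= i)%N ->
    R t = reattach (pendant t) (w t) (w (prev_pos q t)).
  exact: (rotate_fe (C := C)).
have detE : [set x; y] :|: \bigcup_(2 <= t < i.+1) third_edge C w1 q t =
    [set h | [exists t : 'I_i.+1, h == pendant t]].
  apply/setP => h; rewrite !inE; apply/idP/existsP.
    case/orP => [/orP[]/eqP->|/mem_bigcup_nat[[//|t] tb]].
    - by exists ord0.
    - by exists ord_max; rewrite /= pendant_last.
    have ti : (t < i.+1)%N by lia.
    by rewrite third_edgeE ?inE; [exists (Ordinal ti) | lia].
  move=> [t /eqP->]; have [->|t0] := posnP t; first by rewrite pendant0 eqxx.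
  have [->|tni] := eqVneq (t : nat) i; first by rewrite pendant_last eqxx orbT.
  apply/orP; right; apply/mem_bigcup_nat; exists t.+1; first by have := ltn_ord t; lia.
  by rewrite third_edgeE ?inE //; have := ltn_ord t; lia.
have reaE : [set reattach x (pvertex w1 q 1) (pvertex w1 q i.+1);
                 reattach y (pvertex w1 q i.+1) (pvertex w1 q i)]
      :|: \bigcup_(2 <= t < i.+1)
            [set reattach f (pvertex w1 q t) (pvertex w1 q t.-1)
               | f in third_edge C w1 q t] =
    [set h | [exists t : 'I_i.+1, h == R t]].
  have R0 : R 0%N = reattach x (pvertex w1 q 1) (pvertex w1 q i.+1) by rewrite RE.
  have Ri : R i = reattach y (pvertex w1 q i.+1) (pvertex w1 q i).
    by rewrite RE // pendant_last /prev_pos gtn_eqF.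
  have Rt t : (0 < t < i)%N ->
      [set reattach f (pvertex w1 q t.+1) (pvertex w1 q t.+1.-1)
         | f in third_edge C w1 q t.+1] = [set R t].
    move=> tb; rewrite third_edgeE // imset_set1 RE; last lia.
    by rewrite /prev_pos gtn_eqF //; case/andP: tb.
  rewrite -R0 -Ri; apply/setP => h; rewrite !inE; apply/idP/existsP.
    case/orP => [/orP[]/eqP->|/mem_bigcup_nat[[//|t] tb]].
    - by exists ord0.
    - by exists ord_max.
    have ti : (t < i.+1)%N by lia.
    by rewrite Rt ?inE; [exists (Ordinal ti) | lia].
  move=> [t /eqP->]; have [->|t0] := posnP t; first by rewrite eqxx.
  have [->|tni] := eqVneq (t : nat) i; first by rewrite eqxx orbT.
  apply/orP; right; apply/mem_bigcup_nat; exists t.+1; first by have := ltn_ord t; lia.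
  by rewrite Rt ?inE //; have := ltn_ord t; lia.
rewrite /shift detE reaE; apply/setP => h; rewrite !inE.
apply/orP/imsetP => [[/andP[hf hC]|/existsP[t /eqP->]]|[g gC ->]].
- exists h => //; rewrite (rotate_id (C := C)) // => t ti; apply: contraNneq hf => ->.
  by apply/existsP; exists (Ordinal (ti : (t < i.+1)%N)).
- by exists (pendant t) => //; apply: feC; rewrite -ltnS.
have [/existsP[t /eqP->]|gf] := boolP [exists t : 'I_i.+1, g == pendant t].
  by right; apply/existsP; exists t.
left; rewrite (rotate_id (C := C)) ?gC ?gf // => t ti; apply: contraNneq gf => ->.
by apply/existsP; exists (Ordinal (ti : (t < i.+1)%N)).
Qed.

(** Each path vertex lies on a path edge and on a pendant off the path. Hence no image under [phi]
    is on the path. *)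
Lemma path_vertex_nonleaf t : (t <= i)%N -> ~~ leaf C (w t).
Proof.
move=> ti; have i0 := connects_size_gt0; have [fC fP wf] := pendantP ti.
have [k ki wk] : exists2 k, (k < i)%N & w t \in [set w k; w k.+1].
  have [tlt|tge] := ltnP t i; first by exists t; rewrite ?set21.
  by exists t.-1; [lia | rewrite prednK ?set22 //; lia].
rewrite /leaf /degree; apply/negP => /cards1P[f fE].
have : pendant t \in [set f in C | w t \in f] by rewrite in_set fC.
have : [set w k; w k.+1] \in [set f in C | w t \in f] by rewrite in_set path_edge_mem.
rewrite fE => /set1P <- /set1P pE; case/negP: fP; rewrite pE.
by apply/path_edgesP; exists k.
Qed.

End ShiftIsRotation.

(** * Widths after the shift *)

Section ShiftedWidths.
Variables (R : realType) (V E N : finType) (G : wgraph R V E).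
Variables (C : {set {set N}}) (phi : V -> N) (x y : {set N}) (w1 : N) (q : seq N).
Variable pi : N -> nat.
Hypothesis tpC : tree_position C phi.
Hypothesis xy : connects C x y w1 q.
Local Notation W := (w1 :: q).
Local Notation P := (path_edges w1 q).
Local Notation i := (size q).
Local Notation w := (nth w1 (w1 :: q)).
Local Notation p k := [set w k; w k.+1].
Local Notation fe := (pendant C x y w1 q).
Local Notation C' := (rotate C w1 q fe pi).
Hypothesis pi_le : forall v, (pi v <= i)%N.
Hypothesis piW : forall k, (k <= i)%N -> pi (w k) = k.
Hypothesis piC : forall a b, [set a; b] \in C -> [set a; b] \notin P -> pi a = pi b.

Let treeC : cayley3 C. Proof. by case: tpC. Qed.
Let C2 f : f \in C -> #|f| = 2%N. Proof. by case: treeC => + _ _ _; apply. Qed.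
Let conC u v : connect (adj C) u v. Proof. by case: treeC. Qed.
Let cuts f : f \in C -> exists S, is_cut C f S. Proof. exact: tree_cut. Qed.
Let simW : simple_path C w1 q. Proof. by case/and5P: xy. Qed.
Let feC t : (t <= i)%N -> fe t \in C. Proof. by case/(pendantP treeC xy). Qed.
Let feP t : (t <= i)%N -> fe t \notin P. Proof. by case/(pendantP treeC xy). Qed.
Let few t : (t <= i)%N -> w t \in fe t. Proof. by case/(pendantP treeC xy). Qed.

Lemma shifted_tree_position : tree_position C' phi.
Proof.
case: tpC => _ phi_inj phi_leaf; split=> //; first exact: rotate_cayley3.
by move=> u; rewrite phi_leaf /leaf (degree_rotate C2).
Qed.

Lemma phi_notin_path v : phi v \notin W.
Proof.
apply/negP => /mem_pathP[t ti vE]; have := path_vertex_nonleaf treeC xy ti.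
by rewrite -vE; case: tpC => _ _ <-; rewrite codom_f.
Qed.

Lemma passing_rotate h S : h \in C ->
  (forall g, g \in C -> crosses S (rotate_edge w1 q fe pi g) = (g == h)) ->
  passing G C' phi (rotate_edge w1 q fe pi h) =
  [set e | crosses (phi @^-1: S) (ends G e)].
Proof.
move=> hC cS; apply: passing_cut; first exact: connect_rotate.
exact: rotate_is_cut.
Qed.

Lemma branch_width h : h \in C -> h \notin P ->
  edge_width G C' phi (rotate_edge w1 q fe pi h) = edge_width G C phi h.
Proof.
move=> hC hP; have [S cS SW] := branch_cut cuts simW hC hP.
rewrite /edge_width (passing_rotate (S := S)) ?(passing_cut G phi conC cS) //.
by move=> g gC; rewrite (cross_rotate _ C2) // cS.
Qed.

Lemma path_passing k : (k < i)%N ->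
  passing G C phi (p k) =
  [set e | crosses (phi @^-1: [set v | pi v <= k]%N) (ends G e)].
Proof. by move=> ki; apply: passing_cut => //; apply: position_cut. Qed.

(** At an inner vertex the pendant is the only branch, so its side fills the fibre off the path. At
    the two ends of the path another branch remains, so only an inclusion is claimed. *)
Lemma pendant_cuts : exists B : nat -> {set N}, forall t, (t <= i)%N ->
  [/\ is_cut C (fe t) (B t), [disjoint B t & W], B t \subset [set v | pi v == t]
    & (0 < t < i)%N -> forall v, v \notin W -> pi v = t -> v \in B t].
Proof.
suff /choice[B HB] : forall t, exists B, (t <= i)%N ->
    [/\ is_cut C (fe t) B, [disjoint B & W], B \subset [set v | pi v == t]
      & (0 < t < i)%N -> forall v, v \notin W -> pi v = t -> v \in B].
  by exists B.
move=> t; have [ti|] := boolP (t <= i)%N; last by exists set0.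
have [tb|tb] := boolP (0 < t < i)%N; last first.
  by have [S cS [SW Spi]] := fe_cut C2 cuts simW feC feP few piW piC ti; exists S.
exists [set v | (pi v == t) && (v \notin W)] => _; split.
- apply: lone_fe_cut => // h hC hP wh.
  by apply/set1P; rewrite -third_edgeE // inE hC hP andbT.
- by rewrite disjoint_subset; apply/subsetP => v; rewrite in_set => /andP[].
- by apply/subsetP => v; rewrite !inE => /andP[].
- by move=> _ v vW vt; rewrite inE vt eqxx.
Qed.

Section WithCuts.
Variable B : nat -> {set N}.
Hypothesis HB : forall t, (t <= i)%N ->
  [/\ is_cut C (fe t) (B t), [disjoint B t & W], B t \subset [set v | pi v == t]
    & (0 < t < i)%N -> forall v, v \notin W -> pi v = t -> v \in B t].
Let i0 : (0 < i)%N := connects_size_gt0 xy.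

Lemma B_pi t v : (t <= i)%N -> v \in B t -> pi v = t.
Proof. by move=> /HB[_ _ /subsetP sub _] /sub; rewrite inE => /eqP. Qed.

Lemma x_passing : passing G C phi x = [set e | crosses (phi @^-1: B 0) (ends G e)].
Proof. by apply: passing_cut => //; case: (HB (leq0n i)). Qed.

Lemma y_passing : passing G C phi y = [set e | crosses (phi @^-1: B i) (ends G e)].
Proof.
apply: passing_cut => //; rewrite -(pendant_last xy).
by case: (HB (leqnn i)).
Qed.

Lemma shifted_path_passing k : (k < i)%N ->
  passing G C' phi (p k) =
  [set e | crosses (phi @^-1: [set v | new_pi w1 q pi B v <= k]%N) (ends G e)].
Proof.
move=> ki; have kP : p k \in P by apply/path_edgesP; exists k.
rewrite -{1}(rotate_path_edge (C := C) simW feP pi_le kP).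
apply: passing_rotate => [|g gC]; first exact: path_edge_in kP.
by rewrite (new_position_cut (C := C)) // => t /HB[].
Qed.

Lemma new_pi_phi v : new_pi w1 q pi B (phi v) =
  if phi v \in B (pi (phi v)) then prev_pos q (pi (phi v)) else pi (phi v).
Proof. by rewrite /new_pi phi_notin_path. Qed.

(** Expresses membership through [B (pi v)], so that a single Boolean and the position of [v] govern
    the case analyses below. *)
Lemma B0E v : (v \in B 0) = (v \in B (pi v)) && (pi v == 0%N).
Proof.
apply/idP/andP => [vB|[vB /eqP v0]]; last by rewrite -v0.
by rewrite (B_pi (leq0n i) vB).
Qed.

Lemma BiE v : (v \in B i) = (v \in B (pi v)) && (pi v == i).
Proof.
apply/idP/andP => [vB|[vB /eqP v0]]; last by rewrite -[in B i]v0.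
by rewrite (B_pi (leqnn i) vB).
Qed.

Lemma B_inner v : (0 < pi (phi v) < i)%N -> phi v \in B (pi (phi v)).
Proof.
move=> vb; have [_ _ _ inner] := HB (pi_le (phi v)).
by apply: inner => //; apply: phi_notin_path.
Qed.

(* On the leaves, the side of p k after the shift is the old side of p k.+1
   with the branch x removed. *)
Lemma inner_passing k e : (k.+1 < i)%N ->
  (e \in passing G C' phi (p k)) =
  (e \in passing G C phi (p k.+1)) (+) (e \in passing G C phi x).
Proof.
move=> ki; rewrite shifted_path_passing ?(ltnW ki) // path_passing // x_passing !inE.
apply: crosses_addb; first exact: ends_card2.
move=> v _; rewrite !in_set new_pi_phi B0E.
(* A leaf that does not move has position 0 or i; one that moves goes from 0 to i or down by one. *)
have := @B_inner v; have := pi_le (phi v); rewrite /prev_pos.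
by case: (phi v \in B (pi (phi v))); case: eqP => [->|] //=; lia.
Qed.

(* For the last path edge the branch y moreover joins the side of w_1. *)
Lemma last_passing k e : k.+1 = i ->
  (e \in passing G C' phi (p k)) =
  (e \in passing G C phi (p k)) (+) (e \in passing G C phi x)
    (+) (e \in passing G C phi y).
Proof.
move=> kE; have ki : (k < i)%N by rewrite -kE.
rewrite shifted_path_passing // path_passing // x_passing y_passing !inE.
(* The symmetric difference of two of the three sides, so that [crosses_addb] can be applied
   twice. *)
pose S := (phi @^-1: [set v | pi v <= k]%N) :\: (phi @^-1: B 0)
          :|: (phi @^-1: B 0) :\: (phi @^-1: [set v | pi v <= k]%N).
have SE v : v \in S = (v \in phi @^-1: [set v | pi v <= k]%N) (+) (v \in phi @^-1: B 0).
  by rewrite !inE; case: (phi v \in B 0); case: (_ <= k)%N.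
rewrite -(crosses_addb (S := S)) ?ends_card2 //.
apply: crosses_addb; first exact: ends_card2.
move=> v _; rewrite SE !in_set new_pi_phi B0E BiE.
have := @B_inner v; have := pi_le (phi v); rewrite /prev_pos.
case: (phi v \in B (pi (phi v))); case: eqP => [->|] //=; lia.
Qed.

(** Such an edge has one end at position 0 and the other at position i, so it crosses every path
    edge. *)
Lemma x_y_sides e : e \in passing G C phi x -> e \in passing G C phi y ->
  forall k, (k < i)%N -> e \in passing G C phi (p k).
Proof.
move=> ex ey k ki; move: ex ey; rewrite x_passing y_passing path_passing // !inE.
have /eqP/cards2P[v [v' [_ ->]]] := ends_card2 G e.
rewrite !crosses2 !inE !B0E !BiE.
have := pi_le (phi v); have := pi_le (phi v').
by case: (_ \in _); case: (_ \in _) => //=; lia.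
Qed.

(** One end is at position 0, and crossing [p k] puts the other beyond k, hence beyond j. *)
Lemma x_path_sides e j k : (j <= k < i)%N -> e \in passing G C phi x ->
  e \in passing G C phi (p k) -> e \in passing G C phi (p j).
Proof.
move=> jki; rewrite x_passing !path_passing ?inE; try lia.
have /eqP/cards2P[v [v' [_ ->]]] := ends_card2 G e.
rewrite !crosses2 !inE !B0E.
by case: (_ \in _); case: (_ \in _) => //=; lia.
Qed.

Lemma inner_width k : (k.+1 < i)%N ->
  edge_width G C' phi (p k) = edge_width G C phi (p k.+1) + slope G C phi (p k.+1) x.
Proof. by move=> ki; apply: wt_addb => e; apply: inner_passing. Qed.

Lemma last_width k : k.+1 = i ->
  edge_width G C' phi (p k) = edge_width G C phi (p k) +
    (slope G C phi (p k) x + slope G C phi (p k) y + 2 * adj_weight G C phi x y).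
Proof.
move=> kE; apply: wt_addb2 => [e|]; first exact: last_passing.
apply/subsetP => e /setIP[ex ey].
by apply: (x_y_sides ex ey); rewrite -kE.
Qed.

Lemma slope_le j k : (j <= k < i)%N ->
  slope G C phi (p j) x <= slope G C phi (p k) x.
Proof.
move=> jki; apply: wt_slope_le; apply/subsetP => e /setIP[ex ek].
exact: x_path_sides ek.
Qed.

End WithCuts.

Lemma shifted_width_lt :
  slope G C phi (p i.-1) x < 0 ->
  (forall t, (t.+1 < i)%N -> edge_width G C phi (p t) <= edge_width G C phi (p t.+1)) ->
  slope G C phi (p i.-1) x + slope G C phi (p i.-1) y + 2 * adj_weight G C phi x y < 0 ->
  (width G C' phi < width G C phi)%O.
Proof.
move=> sx mono sxy; have [B HB] := pendant_cuts.
have i0 := connects_size_gt0 xy; have iE := prednK i0.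
pose M := edge_width G C phi (p i.-1).
have leM k : (k < i)%N -> edge_width G C phi (p k) <= M.
  (* Induction on the distance to the last path edge. *)
  move=> ki; have -> : k = (i.-1 - (i.-1 - k))%N by lia.
  elim: (i.-1 - k)%N => [|d IHd]; first by rewrite subn0.
  have [di|di] := leqP i.-1 d.
    by have -> : (i.-1 - d.+1 = i.-1 - d)%N by lia.
  apply: le_trans IHd; have -> : (i.-1 - d = (i.-1 - d.+1).+1)%N by lia.
  by apply: mono; lia.
have ltM k : (k < i)%N -> edge_width G C' phi (p k) < M.
  move=> ki; have [kE|kE] := eqVneq k.+1 i.
    have kE' : k = i.-1 by rewrite -kE.
    by rewrite (last_width HB kE) /M -kE' gtrDl kE'.
  have ki' : (k.+1 < i)%N by rewrite ltn_neqAle kE.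
  (* The slope at [p k.+1] is at most the one at the last path edge, which is negative. *)
  rewrite (inner_width HB ki'); apply: lt_le_trans (leM _ ki').
  rewrite gtrDl; apply: le_lt_trans sx; apply: (slope_le HB); lia.
rewrite /width.
(* Injectivity of [rotate_edge] lets both widths be listed over the old edges, for an edgewise
   comparison. *)
have /perm_sortP -> : perm_eq [seq edge_width G C' phi f | f <- enum C']
    [seq edge_width G C' phi (rotate_edge w1 q fe pi h) | h <- enum C].
- suff : perm_eq (enum C') [seq rotate_edge w1 q fe pi h | h <- enum C].
    by move=> /(perm_map (edge_width G C' phi)); rewrite -map_comp.
  apply: uniq_perm; first exact: enum_uniq.
    rewrite map_inj_in_uniq ?enum_uniq // => g h; rewrite !mem_enum.
    exact: rotate_edge_inj.
  move=> f; rewrite mem_enum; apply/imsetP/mapP => -[h hC ->]; exists h => //.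
    by rewrite mem_enum.
  by rewrite mem_enum in hC.
- apply: (sort_lexi_lt (M := M)) => [h|].
    rewrite mem_enum => hC; have [hP|hP] := boolP (h \in P); last by left; apply: branch_width.
    right; have [k ki hE] := path_edgesP _ _ _ hP.
    by rewrite (rotate_path_edge (C := C)) // hE ltM ?leM.
  have ki : (i.-1 < i)%N by lia.
  have kP : p i.-1 \in P by apply/path_edgesP; exists i.-1.
  exists (p i.-1); first by rewrite mem_enum; apply: path_edge_in kP.
  by split=> //; rewrite (rotate_path_edge (C := C)) // ltM.
- by move=> a b; exact: ge_total.
- by move=> a b c; exact: ge_trans.
- by move=> a b; exact: ge_anti.
Qed.

End ShiftedWidths.

Theorem lemma8 (R : realType) (V E N : finType) (G : wgraph R V E)
    (C : {set {set N}}) (phi : V -> N) (x y : {set N}) (w1 : N) (q : seq N)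
    (hC : tree_position C phi)
    (hxy : connects C x y w1 q)
    (p := pedge w1 q) (i := size q)
    (h1 : slope G C phi (p i) x < 0)
    (h2 : forall t : nat, (1 < t <= i)%N ->
            edge_width G C phi (p t.-1) <= edge_width G C phi (p t))
    (h3 : slope G C phi (p i) x + slope G C phi (p i) y
            + 2 * adj_weight G C phi x y < 0) :
  weakly_reducible G C phi /\
  (tree_position (shift C x y w1 q) phi /\
   (width G (shift C x y w1 q) phi < width G C phi)%O).
Proof.
have [treeC _ _] := hC.
have simW : simple_path C w1 q by case/and5P: hxy.
have [pi [pi_le piW piC]] := path_projection (fun f => tree_cut treeC) simW.
have pE t : (t < i)%N -> p t.+1 = [set nth w1 (w1 :: q) t; nth w1 (w1 :: q) t.+1].
  exact: nth_path_edges.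
have i0 : (0 < i)%N := connects_size_gt0 hxy.
have piE : p i = [set nth w1 (w1 :: q) i.-1; nth w1 (w1 :: q) i.-1.+1].
  by rewrite -pE ?prednK.
have shE := shift_rotate treeC hxy piW pi_le piC.
have tp : tree_position (shift C x y w1 q) phi.
  by rewrite shE; apply: shifted_tree_position.
have lt_width : (width G (shift C x y w1 q) phi < width G C phi)%O.
  rewrite shE; apply: shifted_width_lt => //; rewrite -?piE //.
  (* Positions here count from 0 while [pedge] counts from 1, so the pair t, t+1 becomes t+1,
     t+2. *)
  by move=> t ti; rewrite -!pE ?(ltnW ti) //; apply: (h2 t.+2).
by split=> //; exists x, y, w1, q.
Qed.
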